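(* Let $G$ be a profinite group having only countably many squares, i.e. such that the set $\{x^2 \mid x\in G\}$ is countable. Then $G^2$ is finite.
   Context: For a profinite group $G$ and an integer $n$, $G^n$ denotes the closed subgroup of $G$ (topologically) generated by all $n$-th powers $x^n$, $x\in G$. ''Countable'' means finite or countably infinite. *)

(* Defs.v *)
From HB Require Import structures.
From mathcomp Require Import all_boot.
From mathcomp Require Import all_classical all_analysis.

Set Implicit Arguments.
Unset Strict Implicit.
Unset Printing Implicit Defensive.

Local Open Scope classical_set_scope.
Local Open Scope group_scope.

#[short(type="preTopologicalGroupType")]
HB.structure Definition PreTopologicalGroup := {G of Topological G & Group G}.

HB.mixin Record PreTopologicalGroup_isTopologicalGroup G
    & PreTopologicalGroup G := {
  mulg_continuous : continuous (fun x : G * G => x.1 * x.2) ;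
  invg_continuous : continuous (fun x : G => x^-1) ;
}.

#[short(type="topologicalGroupType")]
HB.structure Definition TopologicalGroup :=
  {G of PreTopologicalGroup G & PreTopologicalGroup_isTopologicalGroup G}.

Definition profinite (G : topologicalGroupType) : Prop :=
  [/\ compact [set: G], hausdorff_space G & totally_disconnected [set: G]].

Definition closed_subgroup (G : topologicalGroupType) (H : set G) : Prop :=
  [/\ H 1, (forall x y, H x -> H y -> H (x * y)),
      (forall x, H x -> H x^-1) & closed H].

Definition closed_subgroup_gen (G : topologicalGroupType) (A : set G) : set G :=
  smallest (@closed_subgroup G) A.

(* The group written G^n. Natural exponents suffice: x^(-n) = (x^-1)^n, so the *)
(* n-th and the (-n)-th powers form the same set.                              *)
Definition power_subgroup (G : topologicalGroupType) (n : nat) : set G :=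
  closed_subgroup_gen [set x ^+ n | x in [set: G]].
Arguments power_subgroup G n : clear implicits.

Lemma closed_subgroup_gen_closed_subgroup (G : topologicalGroupType)
  (A : set G) : closed_subgroup (closed_subgroup_gen A).
Proof.
split.
- by move=> H [[]].
- by move=> x y Ax Ay H HA; case: (HA) => -[_ HM _ _] _; apply: HM;
    [exact: Ax|exact: Ay].
- by move=> x Ax H HA; case: (HA) => -[_ _ HV _] _; apply: HV; exact: Ax.
- by apply: closed_bigI => H [[]].
Qed.

(* Main.v *)
(** By Baire, the points at which squaring is locally constant are dense. At
such a point g one has m g m = g for all m near 1, so conjugation by g inverts
every element near 1, and therefore elements near 1 commute. Given any t, pick
n near 1 such that squaring is locally constant at t n: for m near 1 we get
m t n m = t n, hence m t m = t since m and n commute, that is (t m)^2 = t^2.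
Thus squaring is locally constant everywhere, and by compactness the set S of
squares is finite. As S is stable under conjugation and squaring, a word in S
with a repeated letter can be shortened, u s v s w = u (s s) (v^s) w, so every
product of elements of S is one of at most |S| factors. *)
Require Import Defs.
From HB Require Import structures.
From mathcomp Require Import all_boot.
From mathcomp Require Import all_classical all_analysis.

Local Open Scope classical_set_scope.
Local Open Scope group_scope.

(** If no [F n] had interior inside [U], one could choose nonempty open sets [W n] in [U] with the
    closure of [W n.+1] inside [W n] minus [F n]. By compactness these closures share a point, which
    lies in [U] but in no [F n]. *)
Lemma compact_hausdorff_baire (T : topologicalType) (F : nat -> set T)
    (U : set T) :
  hausdorff_space T -> compact [set: T] -> (forall n, closed (F n)) ->
  open U -> U !=set0 -> U `<=` \bigcup_n F n ->
  exists n, U `&` (F n)° !=set0.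
Proof.
move=> hT cT clF oU U0 UF; apply: contrapT => noF.
pose good (W : set T) := [/\ open W, W !=set0 & W `<=` U].
have step (nW : nat * {W | good W}) :
    exists W' : {W | good W}, closure (sval W') `<=` sval nW.2 `&` ~` F nW.1.
  case: nW => n [W [oW [x Wx] WU]] /=.
  have [y Wy nFy] : exists2 y, W y & ~ F n y.
    apply: contrapT => allF; apply: noF; exists n, x; split; first exact: WU.
    rewrite /interior; apply: (@filterS _ _ _ W); last exact: open_nbhs_nbhs.
    by move=> z Wz; apply: contrapT => nFz; apply: allF; exists z.
  have nyW : nbhs y (W `&` ~` F n).
    by apply: open_nbhs_nbhs; split=> //; apply: openI => //; exact: closed_openC.
  have [V nV clV] := compact_regular hT cT (filterT : nbhs y setT) nyW.
  have gV : good V°.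
    split; [exact: open_interior | by exists y |].
    move=> z /interior_subset Vz; apply: WU.
    by case: (clV z (subset_closure Vz)).
  exists (exist good _ gV) => /= z Vz; apply: clV.
  exact: (closureS (@interior_subset _ V)).
have [next nextP] := choice step.
pose W := fix W n := if n is k.+1 then next (k, W k)
                     else exist good U (And3 oU U0 (fun x Ux => Ux)).
have Wdecr m n : (m <= n)%N -> sval (W n) `<=` sval (W m).
  elim: n => [|n IHn]; first by rewrite leqn0 => /eqP->.
  rewrite leq_eqVlt => /predU1P[-> //|lemn]; apply: subset_trans (IHn lemn).
  by move=> x /subset_closure/nextP[].
pose B := filter_from [set: nat] (fun n => sval (W n)).
have BP : ProperFilter B.
  apply: filter_from_proper => [|n _]; last by case: (svalP (W n)).
  apply: filter_fromT_filter => [|i j]; first by exists 0%N.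
  by exists (maxn i j); rewrite subsetI; split; apply: Wdecr;
    rewrite ?leq_maxl ?leq_maxr.
have [p [_ clp]] := cT B BP filterT.
have Wp n : closure (sval (W n)) p by move=> V; apply: clp; exists n.
have /UF[n _ Fp] : U p by have [] := nextP (0%N, W 0%N) p (Wp 1%N).
by have [_] := nextP (n, W n) p (Wp n.+1).
Qed.

(** If the image were infinite, the sets whose complement has finite image would form a proper
    filter. At a cluster point [p], the fibre of [f p] is a neighbourhood whose complement belongs
    to this filter, a contradiction. *)
Lemma compact_finite_image (T : topologicalType) (Y : Type) (f : T -> Y) :
  compact [set: T] -> (forall x, \forall y \near x, f y = f x) ->
  finite_set [set f x | x in [set: T]].
Proof.
move=> cT fP; apply: contrapT => infT.
pose F (A : set T) := finite_set [set f x | x in ~` A].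
have FP : ProperFilter F.
  apply: Build_ProperFilter_ex => [A FA|].
    apply: contrapT => A0; apply: infT.
    by apply: sub_finite_set FA => _ [x _ <-]; exists x => // Ax; apply: A0; exists x.
  split=> [|A B FA FB|A B AB FA]; rewrite /F.
  - by rewrite setCT image_set0; exact: finite_set0.
  - by rewrite setCI image_setU finite_setU.
  - by apply: sub_finite_set FA; apply: image_subset; exact: subsetC.
have [p [_ clp]] := cT F FP filterT.
have FU : F (~` [set y | f y = f p]).
  rewrite /F setCK; apply: sub_finite_set (finite_set1 (f p)).
  by move=> _ [y /= -> <-].
by have [y []] := clp _ _ FU (fP p).
Qed.

(** An injection [g] of the image into [nat] numbers the fibres, each of them closed; by Baire one
    has an interior point in [U]. *)
Lemma countable_image_locally_constant (T Y : topologicalType) (f : T -> Y)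
    (U : set T) :
  hausdorff_space T -> compact [set: T] -> hausdorff_space Y ->
  continuous f -> countable [set f x | x in [set: T]] ->
  open U -> U !=set0 -> exists2 x, U x & \forall y \near x, f y = f x.
Proof.
move=> hT cT hY cf /countable_injP[g ginj] oU U0.
have clF n : closed [set x | g (f x) = n].
  have [[x0 gx0]|nex] := pselect (exists x, g (f x) = n).
    have -> : [set x | g (f x) = n] = f @^-1` [set f x0].
      apply/seteqP; split=> x /=; last by move=> ->.
      by rewrite -gx0; apply: ginj; apply/mem_set; [exists x | exists x0].
    apply: preimage_closed => [x _|]; first exact: cf.
    apply: (accessible_finite_set_closed.1 (hausdorff_accessible hY)).
    exact: finite_set1.
  rewrite (_ : [set x | _] = set0); first exact: closed0.
  by apply/seteqP; split=> // x gx; apply: nex; exists x.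
have [|n [x [Ux nx]]] := compact_hausdorff_baire _ _ _ hT cT clF oU U0.
  by move=> x _; exists (g (f x)).
have gx := nbhs_singleton nx.
exists x => //; apply: filterS nx => y /= gy.
apply: ginj; [by apply/mem_set; exists y | by apply/mem_set; exists x |].
by rewrite gy gx.
Qed.

Section LocallyConstantSquaring.
Variable G : topologicalGroupType.

Lemma continuous_mulg (T : topologicalType) (f g : T -> G) :
  continuous f -> continuous g -> continuous (fun x => f x * g x).
Proof.
move=> cf cg x.
exact: (@continuous2_cvg T G G G (nbhs x) _ f g (fun a b => a * b) _ _
          (@mulg_continuous G (f x, g x)) (cf x) (cg x)).
Qed.

Lemma near_mulgl (t : G) (P : set G) :
  (\forall y \near t, P y) <-> \forall m \near (1 : G), P (t * m).
Proof.
have cmul (a : G) : continuous (fun y : G => a * y).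
  by apply: continuous_mulg => x; [exact: cvg_cst | exact: cvg_id].
split=> Pt; first by apply: (cmul t 1); rewrite /= mulg1.
have := cmul t^-1 t (fun m => P (t * m)); rewrite mulVg => /(_ Pt) nP.
by apply: (filterS _ (nP : nbhs t _)) => y /=; rewrite mulVKg.
Qed.

Lemma sqr_const_invert (g m : G) : (g * m) ^+ 2 = g ^+ 2 -> m * g * m = g.
Proof. by rewrite !expg2 -!mulgA => /mulgI. Qed.

Lemma locally_commute (g : G) :
  (\forall y \near g, y ^+ 2 = g ^+ 2) ->
  exists2 V : set G, nbhs 1 V & {in V &, forall a b, commute a b}.
Proof.
move=> /near_mulgl gP.
have invP : \forall m \near (1 : G), m * g * m = g.
  by apply: filterS gP => m /sqr_const_invert.
(* Continuity at [(1, 1)] makes the relation hold at [a * b] as well as at [a] and [b]. *)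
have := @mulg_continuous G (1, 1) (fun m => m * g * m = g).
rewrite /= mulg1 => /(_ invP)[[A B] /= [nA nB] ABP].
exists (A `&` B `&` [set m | m * g * m = g]).
  by apply: filterI => //; apply: filterI.
move=> a b /set_mem[[Aa Ba] ga] /set_mem[[Ab Bb] gb].
have gab : a * b * g * (a * b) = g by apply: (ABP (a, b)).
(* [a b g a b = g = a g a = a (b g b) a] *)
have : a * b * g * (a * b) = a * (b * g * b) * a by rewrite gab gb ga.
by rewrite -!mulgA => /mulgI/mulgI/mulgI.
Qed.

Lemma sqr_locally_constant : compact [set: G] -> hausdorff_space G ->
  countable [set x ^+ 2 | x in [set: G]] ->
  forall t : G, \forall y \near t, y ^+ 2 = t ^+ 2.
Proof.
move=> cG hG hsq.
have csq : continuous (fun x : G => x ^+ 2).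
  by apply: continuous_mulg => x; exact: cvg_id.
have dense := countable_image_locally_constant _ _ _ _ hG cG hG csq hsq.
have [|g _ /locally_commute[V V1 comV]] := dense setT openT.
  by exists 1.
move=> t; have tVt : nbhs t [set y | V (t^-1 * y)].
  by apply/near_mulgl; apply: filterS V1 => m; rewrite /= mulKg.
(* Here [x = t * n] with [n = t^-1 * x] in [V]; as [n] commutes with [m], it cancels from
   [m * x * m = x]. *)
have [|x /interior_subset/= Vx xP] :=
    dense [set y | V (t^-1 * y)]° (@open_interior _ _); first by exists t.
apply/near_mulgl; move/near_mulgl: xP; apply: filterS2 V1 => m Vm.
move=> /sqr_const_invert mxm.
have cmx : m * (t^-1 * x) = t^-1 * x * m by apply: comV; apply/mem_set.
have : m * t * m * (t^-1 * x) = t * (t^-1 * x).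
  by rewrite -(mulgA _ m) cmx mulgA -(mulgA m) mulVKg.
by move=> /mulIg mtm; rewrite !expg2 -mulgA [m * _]mulgA mtm.
Qed.

End LocallyConstantSquaring.

Section ProductsOfFiniteSet.
Variables (G : groupType) (S : set G).
Hypothesis finS : finite_set S.
Hypothesis conjS : forall x y, S x -> S (x ^ y).
Hypothesis sqrS : forall x, S x -> S (x * x).

(** The submonoid generated by [S]. When [S] is the set of squares it is a subgroup, since inverses
    of squares are squares. *)
Definition products : set G :=
  [set \prod_(x <- s) x | s in [set s : seq G | {in s, forall x, S x}]].

Lemma products_shorten (s : seq G) : {in s, forall x, S x} -> ~~ uniq s ->
  exists s', [/\ {in s', forall x, S x}, (size s' < size s)%N
               & \prod_(x <- s') x = \prod_(x <- s) x].
Proof.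
elim: s => // x s IHs Ss /=; rewrite negb_and negbK.
have [/[dup] xs /splitPr E _|_ /= nus] := boolP (x \in s).
  case: E Ss {xs IHs} => u v Ss.
  (* The second [x] moves left past [u] at the cost of conjugating [u], then merges with the
     first. *)
  exists (x * x :: [seq y ^ x | y <- u] ++ v); split.
  - move=> y; rewrite inE mem_cat => /predU1P[->|/orP[/mapP[z zu ->]|yv]].
    + by apply/sqrS/Ss; rewrite inE eqxx.
    + by apply/conjS/Ss; rewrite inE mem_cat zu orbT.
    + by apply/Ss; rewrite inE mem_cat inE yv !orbT.
  - by rewrite /= !size_cat size_map /= addnS.
  - rewrite !big_cons !big_cat /= big_cons big_map -conjg_prod conjgE.
    by rewrite !mulgA mulgK.
have [|s' [Ss' lts' eqs']] := IHs _ nus.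
  by move=> y ys; apply: Ss; rewrite inE ys orbT.
exists (x :: s'); split => //; last by rewrite !big_cons eqs'.
move=> y; rewrite inE => /predU1P[->|/Ss' //]; apply: Ss; exact: mem_head.
Qed.

Lemma finite_products : finite_set products.
Proof.
have [l Sl] := (finite_seqP S).1 finS.
(* Products of at most [n] factors from [S], padded by [1] to exactly [n] factors. *)
pose P := fix P n := if n is k.+1 then [set x * y | x in 1 |` S & y in P k]
                     else [set (1 : G)].
have finP n : finite_set (P n).
  elim: n => [|n IHn] /=; first exact: finite_set1.
  by apply: finite_image2 => //; rewrite finite_setU; split.
apply: sub_finite_set (finP (size l)) => _ [s Ss <-].
(* Strong induction on length reduces to duplicate-free words, whose length is at most that of the
   enumeration [l] of [S]. *)
have [n] := ubnP (size s); elim: n s Ss => // n IHn s Ss lts.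
have [us|/(products_shorten _ Ss)[s' [Ss' lts' <-]]] := boolP (uniq s); last first.
  by apply: IHn => //; apply: leq_trans lts' _.
have : (size s <= size l)%N.
  by apply: uniq_leq_size => // x /Ss; rewrite Sl.
elim: (size l) s Ss {lts us} => [|k IHk] [|x s] //= Ss lesk.
- by rewrite big_nil.
- exists 1; first by left.
  by exists (\prod_(y <- [::]) y); [exact: IHk | rewrite mul1g].
- rewrite big_cons; exists x; first by right; apply: Ss; exact: mem_head.
  exists (\prod_(y <- s) y) => //; apply: IHk => // y ys.
  by apply: Ss; rewrite inE ys orbT.
Qed.

End ProductsOfFiniteSet.

Theorem theorem1p2 (G : topologicalGroupType) (hG : profinite G)
  (hsq : countable [set x ^+ 2 | x in [set: G]]) :
  finite_set (power_subgroup G 2).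
Proof.
have [cG haus _] := hG.
set S := [set x ^+ 2 | x in [set: G]].
have finS : finite_set S.
  by apply: compact_finite_image _ _ _ cG (sqr_locally_constant _ cG haus hsq).
have finP : finite_set (products G S).
  apply: finite_products finS _ _ => [_ y [x _ <-]|_ [x _ <-]].
    by exists (x ^ y) => //; rewrite conjXg.
  by exists (x ^+ 2).
have clP : closed (products G S).
  exact: (accessible_finite_set_closed.1 (hausdorff_accessible haus)).
(* The generated subgroup is an intersection, so it lies in [products G S] once that set is a closed
   subgroup containing all squares. *)
apply: sub_finite_set finP => x; apply; split; last first.
  move=> y Sy; exists [:: y]; last by rewrite big_seq1.
  by move=> z; rewrite inE => /eqP->.
split=> //.
- by exists [::]; rewrite ?big_nil.
- move=> _ _ [s Ss <-] [t St <-]; exists (s ++ t); last by rewrite big_cat.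
  by move=> y; rewrite mem_cat => /orP[/Ss|/St].
- move=> _ [s Ss <-]; exists (rev [seq y^-1 | y <- s]).
    move=> y; rewrite mem_rev => /mapP[z /Ss[w _ <-] ->].
    by exists w^-1; rewrite ?expVgn.
  elim: s {Ss} => [|y s IHs]; first by rewrite !big_nil invg1.
  by rewrite /= rev_cons -cats1 big_cat big_seq1 /= IHs big_cons invgM.
Qed.
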